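(* Let $k\ge 1$, let $n_1,n_1',n_1'',n_2,\dots,n_k$ be non-negative integers with $n_1=n_1'+n_1''+1$, and let $s,s',s''$, $a_1$, $a_j,a_j',a_j''$ ($2\le j\le k$) be non-negative integers with $s=s'+s''$ and $a_j=a_j'+a_j''$ for $j=2,\dots,k$. Suppose that (1) $T(n_1',n_2,\dots,n_k;\,s';\,a_1+s'',a_2',\dots,a_k')$ is true and subabundant, and (2) $T(n_1'',n_2,\dots,n_k;\,s'';\,a_1+s',a_2'',\dots,a_k'')$ is true and subabundant. Then $T(n_1,n_2,\dots,n_k;\,s;\,a_1,a_2,\dots,a_k)$ is true and subabundant.
   Context: Work over a field of characteristic zero (not necessarily algebraically closed). For non-negative integers $n_1,\dots,n_k$ let $V_i$ be a vector space of dimension $n_i+1$ and let $X=\mathbf{P}^{n_1}\times\cdots\times\mathbf{P}^{n_k}=\mathbf{P}(V_1)\times\cdots\times\mathbf{P}(V_k)$ be the Segre variety embedded in $\mathbf{P}(V_1\otimes\cdots\otimes V_k)$. For a point $p=v_1\otimes\cdots\otimes v_k$ of $X$ put $$G^i_pX=v_1\otimes\cdots\otimes v_{i-1}\otimes V_i\otimes v_{i+1}\otimes\cdots\otimes v_k,\qquad T_pX=\sum_{i=1}^k G^i_pX,$$ both linear subspaces of $V_1\otimes\cdots\otimes V_k$ ($T_pX$ is the affine tangent space). Given non-negative integers $s,a_1,\dots,a_k$, the statement $T(n_1,\dots,n_k;s;a_1,\dots,a_k)$ is said to be true if, for $s+a_1+\cdots+a_k$ generic points $p_1,\dots,p_s$,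 $q_{i,j}$ ($1\le i\le k$, $1\le j\le a_i$) of $X$, the subspace $\sum_{l=1}^sT_{p_l}X+\sum_{i=1}^k\sum_{j=1}^{a_i}G^i_{q_{i,j}}X$ of $V_1\otimes\cdots\otimes V_k$ has dimension $$\min\Big\{s\Big(1+\sum_{i=1}^kn_i\Big)+\sum_{i=1}^ka_i(n_i+1),\ \prod_{i=1}^k(n_i+1)\Big\}.$$ It is called subabundant if $s(1+\sum n_i)+\sum a_i(n_i+1)\le\prod(n_i+1)$. *)

(* Defs.v *)
From HB Require Import structures.
From mathcomp Require Import all_boot all_order all_algebra.
From mathcomp Require Import mpoly.

Set Implicit Arguments.
Unset Strict Implicit.
Unset Printing Implicit Defensive.

Import GRing.Theory.
Local Open Scope ring_scope.

Section Segre.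

Variables (F : fieldType) (k : nat) (n : 'I_k -> nat).

(* [V_i] is [F^(n i + 1)] and [V_1 (x) ... (x) V_k] is the space of
   k-dimensional arrays, the array of [v_1 (x) ... (x) v_k] having entry
   [\prod_i v_i(f_i)] at the multi-index [f]. *)
Definition multi_index : finType := {dffun forall i : 'I_k, 'I_(n i).+1}.

Definition tensor : vectType F := {ffun multi_index -> F^o}.

Definition factors : Type := forall i : 'I_k, 'rV[F]_(n i).+1.

Definition pure (v : factors) : tensor :=
  [ffun f : multi_index => \prod_(i < k) v i 0 ((f : {dffun _}) i)].

(* A point of the Segre variety [P(V_1) x ... x P(V_k)] is given by
   homogeneous coordinates in each factor; two elements of [segre] represent
   the same point when [same_point] holds. *)
Record segre := Segre {
  coords_of :> forall i : 'I_k, 'rV[F]_(n i).+1;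
  coords_neq0 : forall i, coords_of i != 0
}.

Definition same_point (p q : segre) : Prop :=
  forall i, exists2 c : F, c != 0 & q i = c *: p i.

Definition tensor_subst (v : factors) (i : 'I_k) (w : 'rV[F]_(n i).+1) : tensor :=
  pure (dfwith v w).

Fact tensor_subst_is_linear v i : linear (@tensor_subst v i).
Proof.
move=> c w w'; apply/ffunP=> f; rewrite !ffunE.
have pureE u : \prod_(j < k) dfwith v u j 0 ((f : {dffun _}) j) =
    u 0 ((f : {dffun _}) i) * \prod_(j < k | j != i) v j 0 ((f : {dffun _}) j).
  rewrite (bigD1 i) //= dfwith_in; congr (_ * _).
  by apply: eq_bigr => j ji; rewrite dfwith_out // eq_sym.
by rewrite !pureE !mxE mulrDl -mulrA.
Qed.

HB.instance Definition _ v i := GRing.isLinear.Build F 'rV[F]_(n i).+1 tensor _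
  (@tensor_subst v i) (@tensor_subst_is_linear v i).

Definition Gspace (i : 'I_k) (p : segre) : {vspace tensor} :=
  limg (linfun (@tensor_subst p i)).

Definition Tspace (p : segre) : {vspace tensor} := (\sum_(i < k) Gspace i p)%VS.

Fact mem_Gspace i (p : segre) x :
  reflect (exists w : 'rV[F]_(n i).+1, x = pure (dfwith p w)) (x \in Gspace i p).
Proof.
apply: (iffP memv_imgP) => [[w _ ->] | [w ->]]; exists w => //;
  by rewrite ?memvf ?lfunE.
Qed.

Section Generic.

Variable I : finType.

Definition coordinate : finType := {mi : I * 'I_k & 'I_(n mi.2).+1}.

Definition coord (v : I -> segre) (x : coordinate) : F :=
  v (tag x).1 (tag x).2 0 (tagged x).

Definition poly_eval (f : {mpoly F[#|coordinate|]}) (v : I -> segre) : F :=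
  f.@[fun r => coord v (enum_val r)].

(* The Zariski topology of [X^I] is the quotient of the Zariski topology on
   tuples of homogeneous coordinates: an open set is one that is invariant under
   rescaling and is the non-vanishing locus of a family of polynomials. *)
Definition zariski_open (U : (I -> segre) -> Prop) : Prop :=
  (forall v w, (forall m, same_point (v m) (w m)) -> U v -> U w) /\
  exists S : {mpoly F[#|coordinate|]} -> Prop,
    forall v, U v <-> exists2 f, S f & poly_eval f v != 0.

Definition generic (P : (I -> segre) -> Prop) : Prop :=
  exists U, [/\ zariski_open U, exists v, U v & forall v, U v -> P v].

End Generic.

Variables (s : nat) (a : 'I_k -> nat).

(* [inl l] indexes [p_l], and [inr (Tagged _ j)] with tag [i] indexes [q_{i,j}]. *)
Definition point_index : finType := ('I_s + {i : 'I_k & 'I_(a i)})%type.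

Definition span_at (v : point_index -> segre) : {vspace tensor} :=
  (\sum_(l < s) Tspace (v (inl l))
   + \sum_(i < k) \sum_(j < a i) Gspace i (v (inr (Tagged (fun i => 'I_(a i)) j))))%VS.

Definition parameter_count : nat :=
  (s * (1 + \sum_(i < k) n i) + \sum_(i < k) a i * (n i + 1))%N.

Definition ambient_dim : nat := (\prod_(i < k) (n i + 1))%N.

End Segre.

Definition T_true (F : fieldType) k (n : k.-tuple nat) (s : nat)
    (a : k.-tuple nat) : Prop :=
  generic (fun v : point_index s (tnth a) -> segre F (tnth n) =>
    \dim (span_at v)
      = minn (parameter_count (tnth n) s (tnth a)) (ambient_dim (tnth n))).

Definition subabundant k (n : k.-tuple nat) (s : nat) (a : k.-tuple nat) : bool :=
  (parameter_count (tnth n) s (tnth a) <= ambient_dim (tnth n))%N.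

(* Main.v *)
From HB Require Import structures.
Require Import Defs.
From mathcomp Require Import all_boot all_order all_algebra.
From mathcomp Require Import mpoly zify ring.

(** Write the first space as a direct sum V' + V'' of spaces of dimensions
    n1' + 1 and n1'' + 1.  The ambient tensor space then splits as the sum of
    the ambient spaces of the two smaller Segre varieties X' and X'', and the
    parameter counts of the two smaller problems add up to that of the large
    one ([parameter_count_split], [ambient_dim_split]), which already gives
    subabundance.

    Specialise s' of the points p_l to X' and the other s'' to X''.  At a point
    p = v_1 (x) ... (x) v_k of X' the tangent space of X contains that of X',
    and also V'' (x) v_2 (x) ... (x) v_k, which is a space G^1 at a point of
    X''.  A space G^1 of X is the sum of a space G^1 of X' and one of X'', and
    for j >= 2 the point q_{j,l} can be put in X' or in X''.  So the span for
    the special configuration contains the direct sum of a span for the first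
    small problem and one for the second, and its dimension is at least the
    sum of the two parameter counts ([glue_tangent_spans]).  The dimension
    never exceeds the parameter count ([dim_span_at]), and having dimension
    equal to that upper bound is an open condition ([tangent_span_open]), so
    one good configuration is enough.

    The two small configurations are not independent: a point of X' and the
    point of X'' which comes from it share their coordinates in the factors
    2, ..., k.  Both are therefore read off from a single family of vectors u
    in the large spaces, by projecting to the coordinates of V' or of V''
    ([joint_config]).  Such a u is found on the line through a family that is
    good for the first problem and one that is good for the second: along
    this line each of the two genericity conditions is implied by the
    non-vanishing of a nonzero polynomial in one variable
    ([generic_witness]), and a field of characteristic zero, being infinite, has
    a point at which neither polynomial vanishes. *)

Set Implicit Arguments.
Unset Strict Implicit.
Unset Printing Implicit Defensive.

Import GRing.Theory.

(** * Tangent spans, their dimension and semicontinuity *)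

Section Spans.

Local Open Scope ring_scope.

Variables (F : fieldType) (k : nat) (n : 'I_k -> nat).

Lemma tensor_substE (v : factors F n) i (w : 'rV[F]_(n i).+1) (f : multi_index n) :
  tensor_subst v w f =
  w 0 ((f : {dffun _}) i) * \prod_(j < k | j != i) v j 0 ((f : {dffun _}) j).
Proof.
rewrite ffunE (bigD1 i) //= dfwith_in; congr (_ * _).
by apply: eq_bigr => j ji; rewrite dfwith_out // eq_sym.
Qed.

Lemma eq_tensor_subst (v v' : factors F n) i (w : 'rV[F]_(n i).+1) :
  (forall j, j != i -> v j = v' j) -> tensor_subst v w = tensor_subst v' w.
Proof.
move=> vv'; apply/ffunP=> f; rewrite !tensor_substE; congr (_ * _).
by apply: eq_bigr => j /vv' ->.
Qed.

Lemma tensor_subst_id (v : factors F n) i : tensor_subst v (v i) = pure v.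
Proof.
by apply/ffunP=> f; rewrite tensor_substE ffunE [in RHS](bigD1 i).
Qed.

Lemma GspaceP i (p : segre F n) x :
  reflect (exists w : 'rV_(n i).+1, x = tensor_subst p w) (x \in Gspace i p).
Proof. exact: mem_Gspace. Qed.

Lemma tensor_subst_in i (p : segre F n) (w : 'rV_(n i).+1) :
  tensor_subst p w \in Gspace i p.
Proof. by apply/GspaceP; exists w. Qed.

Lemma same_point_sym (p q : segre F n) : same_point p q -> same_point q p.
Proof.
move=> pq i; have [c c0 ->] := pq i; exists c^-1; rewrite ?invr_eq0 //.
by rewrite scalerA mulVf // scale1r.
Qed.

Lemma same_point_Gspace_sub i (p q : segre F n) :
  same_point p q -> (Gspace i q <= Gspace i p)%VS.
Proof.
move=> /fin_all_exists2[c c0 qE]; apply/subvP => x /GspaceP[w ->].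
(* The i-th slot holds [w] at both points; only the other slots are rescaled. *)
rewrite (_ : tensor_subst q w =
  (\prod_(j < k | j != i) c j) *: (tensor_subst p w : tensor F n)).
  by rewrite memvZ // tensor_subst_in.
apply/ffunP=> f; rewrite [in RHS]ffunE !tensor_substE.
rewrite [RHS]mulrCA -big_split /=; congr (_ * _).
by apply: eq_bigr => j _; rewrite qE mxE.
Qed.

Lemma same_point_Gspace i (p q : segre F n) :
  same_point p q -> Gspace i p = Gspace i q.
Proof.
move=> pq; apply/eqP; rewrite eqEsubv.
by rewrite !same_point_Gspace_sub //; apply: same_point_sym.
Qed.

Lemma dim_Gspace i (p : segre F n) : (\dim (Gspace i p) <= n i + 1)%N.
Proof.
have := limg_ker_dim (linfun (@tensor_subst F k n p i)) fullv.
by rewrite dimvf /dim /= mul1n addn1 => <-; apply: leq_addl.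
Qed.

(** The spaces G^i at p share the line of p, so each contributes only [n i]
    further dimensions: that of a complement of [p i] in the i-th factor. *)
Lemma dim_Tspace (p : segre F n) : (\dim (Tspace p) <= 1 + \sum_(i < k) n i)%N.
Proof.
pose U i := (linfun (@tensor_subst F k n p i) @: <[p i]>^C)%VS.
have sub_T : (Tspace p <= <[pure p]> + \sum_(i < k) U i)%VS.
  apply/subv_sumP => i _; apply/subvP => x /GspaceP[w ->].
  have : w \in (<[p i]> + <[p i]>^C)%VS by rewrite addv_complf memvf.
  case/memv_addP => _ /vlineP[c ->] [w2 w2_in ->].
  rewrite linearP /= tensor_subst_id memv_add ?memvZ ?memv_line //.
  apply: (subvP (sumv_sup i _ (subvv _))) => //.
  by rewrite -lfunE memv_img.
apply: leq_trans (dimvS sub_T) _; apply: leq_trans (dimv_add_leqif _ _) _.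
rewrite leq_add ?dim_vline ?leq_b1 //.
apply: leq_trans (dimv_leq_sum _ _ _) _; apply: leq_sum => i _.
apply: leq_trans (_ : \dim (<[p i]>^C)%VS <= _)%N.
  by rewrite -(limg_ker_dim (linfun (@tensor_subst F k n p i))) leq_addl.
by rewrite dimv_compl dim_vline coords_neq0 dimvf /dim /= mul1n subn1.
Qed.

(** A tangent space is a sum of spaces G^i at one point over all directions i,
    so the spans of the problem are sums of spaces G^i over a set [A] of pairs
    (point, direction). *)
Definition tangent_span (I : finType) (A : I -> pred 'I_k) (v : I -> segre F n) :
    {vspace tensor F n} :=
  (\sum_(x : I * 'I_k | A x.1 x.2) Gspace x.2 (v x.1))%VS.

Lemma Gspace_sub_tangent_span (I : finType) (A : I -> pred 'I_k)
    (v : I -> segre F n) m i :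
  A m i -> (Gspace i (v m) <= tangent_span A v)%VS.
Proof. by move=> Ami; apply: (sumv_sup (m, i)). Qed.

Lemma memv_tangent_span (I : finType) (A : I -> pred 'I_k) (v : I -> segre F n) x :
  reflect (exists w : forall y : I * 'I_k, 'rV[F]_(n y.2).+1,
             x = \sum_(y | A y.1 y.2) tensor_subst (v y.1) (w y))
          (x \in tangent_span A v).
Proof.
apply: (iffP memv_sumP) => [[xs xsG ->]|[w ->]]; last first.
  by eexists; last reflexivity; move=> y _; apply: tensor_subst_in.
have /fin_all_exists[w wE] (y : I * 'I_k) : exists w : 'rV[F]_(n y.2).+1,
    A y.1 y.2 -> xs y = tensor_subst (v y.1) w.
  case: (boolP (A y.1 y.2)) => [/xsG/GspaceP[w]|_]; last by exists 0.
  by exists w.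
by exists w; apply: eq_bigr => y /wE.
Qed.

(** The array [fun f => C f l] is the linear form taking [x] to the sum of the
    [x f * C f l]; [pairing_mx] is the table of values of [r] such forms
    on [r] tensors. *)
Definition functionals r := multi_index n -> 'I_r -> F.

Definition pairing_mx r (C : functionals r) (b : 'I_r -> tensor F n) : 'M[F]_r :=
  \matrix_(j, l) \sum_f b j f * C f l.

(** This and [pairing_of_dim] characterise [\dim W] by determinants: r forms
    with a nonsingular table of values on r vectors of [W] witness that these
    vectors are independent, and conversely a basis of [W] has dual forms. *)
Lemma dim_ge_of_pairing r (C : functionals r) (W : {vspace tensor F n}) b :
  (forall j, b j \in W) -> \det (pairing_mx C b) != 0 -> (r <= \dim W)%N.
Proof.
move=> bW det_n0; have free_b : free [tuple b j | j < r].
  apply/freeP => c cb0 j; pose cv := \row_j c j.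
  have cv0 : cv *m pairing_mx C b = 0.
    apply/rowP => l; rewrite !mxE.
    under eq_bigr => i _ do rewrite !mxE mulr_sumr.
    rewrite exchange_big big1 //= => f _.
    under eq_bigr => i _ do rewrite mulrA.
    rewrite -mulr_suml; apply/eqP; rewrite mulf_eq0; apply/orP; left.
    have /ffunP/(_ f) := cb0; rewrite sum_ffunE ffunE => sum0; apply/eqP.
    rewrite -[RHS]sum0; apply: eq_bigr => i _.
    by rewrite -tnth_nth tnth_mktuple ffunE.
  have : cv = 0.
    apply: (can_inj (mulmxK _) : injective (mulmxr (pairing_mx C b))).
      by rewrite unitmxE unitfE.
    by rewrite /= cv0 mul0mx.
  by move/rowP/(_ j); rewrite !mxE.
rewrite -[r in (r <= _)%N](size_tuple [tuple b j | j < r]) -(eqP free_b).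
by apply/dimvS/span_subvP => _ /mapP[j _ ->].
Qed.

Lemma pairing_of_dim (W : {vspace tensor F n}) :
  exists (C : functionals (\dim W)) (b : 'I_(\dim W) -> tensor F n),
    (forall j, b j \in W) /\ \det (pairing_mx C b) != 0.
Proof.
pose delta f : tensor F n := [ffun g => (g == f)%:R].
have deltaE (x : tensor F n) : x = \sum_f x f *: delta f.
  apply/ffunP=> g; rewrite sum_ffunE (bigD1 g) //= big1 ?addr0 => [|f fg].
    by rewrite !ffunE eqxx [RHS]mulr1.
  by rewrite !ffunE eq_sym (negPf fg) [LHS]mulr0.
exists (fun f l => vector.coord (vbasis W) l (delta f)), (fun j => (vbasis W)`_j).
split=> [j|]; first by rewrite -tnth_nth vbasis_mem // mem_tnth.
rewrite (_ : pairing_mx _ _ = 1%:M) ?det1 ?oner_neq0 //.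
apply/matrixP => j l; rewrite !mxE.
rewrite -(coord_free j l (basis_free (vbasisP W))) [in RHS](deltaE (vbasis W)`_j).
by rewrite linear_sum; apply: eq_bigr => f _; rewrite linearZ.
Qed.

Section Open.

Variables (I : finType) (A : I -> pred 'I_k).

(** A vector of V_i for each point and each direction i, chosen once and for all,
    determines an element of the tangent span at every configuration, and the
    entries of this element are polynomials in the coordinates of the points.
    A determinant as in [dim_ge_of_pairing] thus becomes a polynomial. *)
Definition selection := forall y : I * 'I_k, 'rV[F]_(n y.2).+1.

Definition selected (w : selection) (v : I -> segre F n) : tensor F n :=
  \sum_(y | A y.1 y.2) tensor_subst (v y.1) (w y).

Definition coord_var m (i : 'I_k) (j : 'I_(n i).+1) :
    {mpoly F[#|coordinate n I|]} :=
  'X_(enum_rank (Tagged (fun mi : I * 'I_k => 'I_(n mi.2).+1) (j : 'I_(n (m, i).2).+1)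
                 : coordinate n I)).

Definition selected_poly (w : selection) (f : multi_index n) :
    {mpoly F[#|coordinate n I|]} :=
  \sum_(y : I * 'I_k | A y.1 y.2) (w y 0 ((f : {dffun _}) y.2))%:MP *
    \prod_(j < k | j != y.2) coord_var y.1 ((f : {dffun _}) j).

Definition minor_poly r (C : functionals r) (w : 'I_r -> selection) :
    {mpoly F[#|coordinate n I|]} :=
  \det (\matrix_(j, l) \sum_f selected_poly (w j) f * (C f l)%:MP).

Lemma poly_eval_minor r (C : functionals r) (w : 'I_r -> selection)
    (v : I -> segre F n) :
  poly_eval (minor_poly C w) v = \det (pairing_mx C (fun j => selected (w j) v)).
Proof.
rewrite /poly_eval -det_map_mx; congr (\det _).
apply/matrixP=> j l; rewrite !mxE rmorph_sum; apply: eq_bigr => f _.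
rewrite rmorphM /= mevalC; congr (_ * _).
rewrite rmorph_sum sum_ffunE; apply: eq_bigr => y _.
rewrite tensor_substE rmorphM /= mevalC rmorph_prod; congr (_ * _).
by apply: eq_bigr => i _; rewrite /= mevalXU enum_rankK.
Qed.

(** Dimension at least [r] is the non-vanishing of some [minor_poly]; the bound
    turns it into dimension exactly [r]. *)
Lemma tangent_span_open r :
  (forall v, \dim (tangent_span A v) <= r)%N ->
  zariski_open (fun v : I -> segre F n => \dim (tangent_span A v) = r).
Proof.
move=> dim_le; split=> [v w vw <-|].
  congr (\dim _); apply: eq_bigr => y _; apply: esym.
  exact: same_point_Gspace.
exists (fun f => exists (C : functionals r) w, f = minor_poly C w) => v.
split=> [dim_r|[_ [C [w ->]]]]; last first.
  rewrite poly_eval_minor => /dim_ge_of_pairing-le_r.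
  apply/eqP; rewrite eqn_leq dim_le le_r // => j.
  by apply/memv_tangent_span; exists (w j).
have := pairing_of_dim (tangent_span A v); rewrite dim_r => -[C [b [bW det_n0]]].
have /fin_all_exists[w wE] j : exists w : selection, b j = selected w v.
  exact/memv_tangent_span/bW.
exists (minor_poly C w); first by exists C, w.
rewrite poly_eval_minor.
rewrite (_ : pairing_mx _ _ = pairing_mx C b) //.
by apply/matrixP => j l; rewrite !mxE; apply: eq_bigr => f _; rewrite wE.
Qed.

End Open.

Section Line.

Variables (I : finType) (P : (I -> segre F n) -> Prop).
Hypothesis genericP : generic P.

(** Genericity is used only along affine lines of homogeneous coordinates
    through a good configuration [v].  The polynomial [q] is the restriction to
    the line of a polynomial defining the open set, times the
    restriction of one coordinate of each vector of [v] that does not vanish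
    there; the latter keep the vectors nonzero, as [segre] requires. *)
Lemma generic_witness : exists v : I -> segre F n,
  forall (x y : I -> factors F n) (c : F),
    (forall m i, x m i + c *: y m i = v m i) ->
    exists2 q : {poly F}, q.[c] != 0 &
      forall t, q.[t] != 0 -> exists2 v' : I -> segre F n, P v' &
        forall m i, v' m i = x m i + t *: y m i.
Proof.
have [U [[_ [S openU]] [v Uv] UP]] := genericP.
exists v => x y c xyE.
have [f Sf fv_n0] := (openU v).1 Uv.
pose line (z : coordinate n I) : {poly F} :=
  (x (tag z).1 (tag z).2 0 (tagged z))%:P + (y (tag z).1 (tag z).2 0 (tagged z)) *: 'X.
have lineE z t : (line z).[t] =
    (x (tag z).1 (tag z).2 + t *: y (tag z).1 (tag z).2) 0 (tagged z).
  by rewrite !hornerE !mxE mulrC.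
pose qf := mmap (@polyC F) (fun r => line (enum_val r)) f.
have qfE t : qf.[t] = f.@[fun r => (line (enum_val r)).[t]].
  rewrite mevalE horner_sum; apply: eq_bigr => m _.
  rewrite hornerM hornerC horner_prod; congr (_ * _).
  by apply: eq_bigr => r _; rewrite horner_exp.
have /fin_all_exists[z zE] (mi : I * 'I_k) :
    exists j : 'I_(n mi.2).+1, v mi.1 mi.2 0 j != 0.
  by have /rV0Pn := coords_neq0 (v mi.1) mi.2.
pose q := qf * \prod_mi line (Tagged (fun mi : I * 'I_k => 'I_(n mi.2).+1) (z mi)).
exists q => [|t].
  rewrite hornerM mulf_neq0 //.
    rewrite qfE (_ : f.@[_] = poly_eval f v) //; apply: meval_eq => r.
    by rewrite lineE xyE.
  rewrite horner_prod; apply/prodf_neq0 => mi _.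
  by rewrite lineE xyE.
rewrite hornerM horner_prod mulf_eq0 negb_or => /andP[qft /prodf_neq0 zt].
have xy_n0 m i : x m i + t *: y m i != 0.
  apply/eqP => xy0; have := zt (m, i) isT.
  by rewrite lineE /= xy0 mxE eqxx.
exists (fun m => Segre (xy_n0 m)) => //; apply/UP/openU; exists f => //.
rewrite (_ : poly_eval _ _ = qf.[t]) // qfE; apply: meval_eq => r.
by rewrite lineE.
Qed.

End Line.

End Spans.

(** * Embedding a smaller tensor space as a block of coordinates *)

Section RowWindow.

Local Open Scope ring_scope.

Variables (F : fieldType) (m n o : nat).

(** [pad] places a vector in the coordinates [o], ..., [o + m] of a larger space
    and fills with zeros; [crop] reads these coordinates.  With [o = 0] and
    [m = n] they are the identity up to the equality of [m] and [n], so
    the factors that are not split need no transport between types. *)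
Definition pad (w : 'rV[F]_m.+1) : 'rV[F]_n.+1 :=
  \row_j (if (o <= j <= o + m)%N then w 0 (inord (j - o)) else 0).

Definition crop (v : 'rV[F]_n.+1) : 'rV[F]_m.+1 := \row_j v 0 (inord (o + j)).

Lemma crop_line x t y : crop (x + t *: y) = crop x + t *: crop y.
Proof. by apply/rowP=> j; rewrite !mxE. Qed.

Lemma padK : (o + m <= n)%N -> cancel pad crop.
Proof.
move=> fit w; apply/rowP=> j; rewrite !mxE inordK; last by have := ltn_ord j; lia.
by rewrite leq_addr leq_add2l -ltnS ltn_ord /= addKn inord_val.
Qed.

Lemma cropK : o = 0%N -> m = n -> cancel crop pad.
Proof.
move=> o0 mn v; apply/rowP=> j; have lt_j := ltn_ord j.
rewrite !mxE o0 !add0n subn0 mn leq0n -ltnS lt_j /=.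
by rewrite inordK ?inord_val // mn.
Qed.

Lemma pad_neq0 w : (o + m <= n)%N -> w != 0 -> pad w != 0.
Proof.
move=> fit; apply: contraNneq => w0; rewrite -(padK fit w) w0.
by apply/eqP/rowP => j; rewrite !mxE.
Qed.

End RowWindow.

Section TensorWindow.

Local Open Scope ring_scope.

Variables (F : fieldType) (k : nat) (m n o : 'I_k -> nat).
Hypothesis fit : forall i, (o i + m i <= n i)%N.

Definition in_window (f : multi_index n) : bool :=
  [forall i : 'I_k, o i <= (f : {dffun _}) i <= o i + m i]%N.

Definition index_pull (f : multi_index n) : multi_index m :=
  [ffun i : 'I_k => inord ((f : {dffun _}) i - o i) : 'I_(m i).+1].

Definition index_push (g : multi_index m) : multi_index n :=
  [ffun i : 'I_k => inord (o i + (g : {dffun _}) i) : 'I_(n i).+1].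

(** The map of tensor spaces induced by [pad] in every factor; [tensor_pad_subst]
    shows that it acts on pure tensors factor by factor. *)
Definition tensor_pad (x : tensor F m) : tensor F n :=
  [ffun f => if in_window f then x (index_pull f) else 0].

Definition tensor_crop (y : tensor F n) : tensor F m := [ffun g => y (index_push g)].

Fact tensor_pad_is_linear : linear tensor_pad.
Proof.
move=> c x y; apply/ffunP=> f; rewrite !ffunE.
by case: ifP => // _; rewrite [RHS]addr0 [RHS]mulr0.
Qed.

HB.instance Definition _ := GRing.isLinear.Build F (tensor F m) (tensor F n) _
  tensor_pad tensor_pad_is_linear.

Lemma index_pushE (g : multi_index m) i :
  (index_push g : {dffun _}) i = (o i + (g : {dffun _}) i)%N :> nat.
Proof.
rewrite ffunE inordK //; have := ltn_ord ((g : {dffun _}) i); have := fit i; lia.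
Qed.

Lemma tensor_padK : cancel tensor_pad tensor_crop.
Proof.
move=> x; apply/ffunP=> g; rewrite !ffunE ifT.
  congr (x _); apply/ffunP=> i; rewrite ffunE; apply: val_inj.
  by rewrite index_pushE addKn /= inordK.
apply/forallP => i; rewrite index_pushE leq_addr leq_add2l -ltnS.
exact: ltn_ord.
Qed.

Lemma tensor_pad_subst (v : factors F m) i (w : 'rV[F]_(m i).+1) :
  tensor_pad (tensor_subst v w) =
  tensor_subst (fun j => pad (n j) (o j) (v j)) (pad (n i) (o i) w).
Proof.
apply/ffunP=> f; rewrite tensor_substE ffunE.
case: ifP => [/forallP fP|/negbT].
  rewrite tensor_substE !mxE fP ffunE; congr (_ * _).
  by apply: eq_bigr => j _; rewrite !mxE fP ffunE.
rewrite negb_forall => /existsP[j out_j].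
have [ij|ji] := eqVneq j i; first by subst j; rewrite mxE (negPf out_j) mul0r.
by rewrite (bigD1 j) //= !mxE (negPf out_j) mul0r mulr0.
Qed.

Definition tensor_inj : 'Hom(tensor F m, tensor F n) := linfun tensor_pad.

Lemma dim_tensor_inj (W : {vspace tensor F m}) : \dim (tensor_inj @: W) = \dim W.
Proof.
apply: limg_dim_eq; rewrite (_ : lker _ = 0%VS) ?capv0 //; apply/eqP/lker0P.
by move=> x y; rewrite !lfunE; apply: can_inj tensor_padK x y.
Qed.

(** A space G^i at p does not depend on the i-th coordinate vector of p.  Hence
    the points of the large configuration need to agree with the small ones
    only outside the direction [i]; this is what lets one point of the large
    problem serve as different points of the two small ones. *)
Lemma tensor_inj_tangent_span (I' I : finType) (A' : I' -> pred 'I_k)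
    (A : I -> pred 'I_k) (phi : I' -> I) (v' : I' -> segre F m) (v : I -> segre F n) :
  (forall l i, A' l i -> A (phi l) i) ->
  (forall l i j, A' l i -> j != i -> v (phi l) j = pad (n j) (o j) (v' l j)) ->
  (tensor_inj @: tangent_span A' v' <= tangent_span A v)%VS.
Proof.
move=> subA vE; rewrite limg_sum; apply/subv_sumP => -[l i] /= Ali.
apply: subv_trans (Gspace_sub_tangent_span v (subA _ _ Ali)).
apply/subvP => _ /memv_imgP[_ /GspaceP[w ->] ->].
rewrite lfunE /= tensor_pad_subst; apply/GspaceP; exists (pad (n i) (o i) w).
by apply: eq_tensor_subst => j ji; rewrite (vE l i).
Qed.

End TensorWindow.

(** * Joining configurations on two complementary blocks *)

Section Glue.

Local Open Scope ring_scope.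

Lemma exists_common_nonroot (F : fieldType) (p q : {poly F}) :
  [pchar F] =i pred0 -> p != 0 -> q != 0 -> exists2 t, p.[t] != 0 & q.[t] != 0.
Proof.
move=> charF0 p0 q0; have pq0 : p * q != 0 by rewrite mulf_neq0.
pose rs := [seq j%:R : F | j <- iota 0 (size (p * q))].
have uniq_rs : uniq rs.
  have le_inj i j : (i <= j)%N -> i%:R = j%:R :> F -> i = j.
    move=> le_ij /esym/eqP; rewrite -subr_eq0 -natrB // ((pcharf0P F).1 charF0).
    by rewrite subn_eq0 => le_ji; apply/eqP; rewrite eqn_leq le_ij.
  rewrite map_inj_uniq ?iota_uniq // => i j ij.
  by case/orP: (leq_total i j) => /le_inj; [apply|move/(_ (esym ij))].
have /allPn[_ /mapP[j _ ->]] : ~~ all (root (p * q)) rs.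
  apply/negP => /(max_poly_roots pq0)/(_ uniq_rs).
  by rewrite size_map size_iota ltnn.
by rewrite rootE hornerM mulf_eq0 negb_or => /andP[pj qj]; exists j%:R.
Qed.

Variables (F : fieldType) (k : nat) (n n' n'' : 'I_k -> nat) (i0 : 'I_k).
Hypothesis charF0 : [pchar F] =i pred0.
Hypothesis n_i0 : n i0 = (n' i0 + n'' i0 + 1)%N.
Hypothesis n'_out : forall i, i != i0 -> n' i = n i.
Hypothesis n''_out : forall i, i != i0 -> n'' i = n i.

(** The factor [i0] is cut into two complementary blocks; the other factors are
    kept whole, as blocks starting at 0. *)
Definition offset' (i : 'I_k) : nat := 0.
Definition offset'' (i : 'I_k) : nat := if i == i0 then (n' i0).+1 else 0.

Lemma fit' i : (offset' i + n' i <= n i)%N.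
Proof. by have [->|/n'_out ->] := eqVneq i i0; rewrite // /offset'; lia. Qed.

Lemma fit'' i : (offset'' i + n'' i <= n i)%N.
Proof.
by rewrite /offset''; have [->|/n''_out ->] := eqVneq i i0; rewrite // n_i0; lia.
Qed.

(** An entry whose [i0]-th index is at most [n' i0] vanishes on the second
    summand, and the first summand is determined by those entries. *)
Lemma tensor_inj_disjoint (W' : {vspace tensor F n'}) (W'' : {vspace tensor F n''}) :
  ((tensor_inj F n' n offset' @: W') :&: (tensor_inj F n'' n offset'' @: W'') = 0)%VS.
Proof.
apply/eqP; rewrite -subv0; apply/subvP => x; rewrite memv_cap => /andP[].
case/memv_imgP=> y _ xy /memv_imgP[z _ xz]; rewrite memv0; apply/eqP.
rewrite lfunE /= in xy; rewrite lfunE /= in xz.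
have y0 : y = 0.
  rewrite -(tensor_padK fit' y) -xy xz; apply/ffunP=> g; rewrite !ffunE ifF //.
  apply/negP => /forallP/(_ i0); rewrite (index_pushE fit') /offset' /offset'' eqxx.
  by have := ltn_ord ((g : {dffun _}) i0); lia.
by rewrite xy y0 linear0.
Qed.

(** [phi'] and [phi''] send a point of a small problem to the point of the large
    problem whose tangent data contain it, and [side] selects the points
    specialised to the first block.  A point of the other block can still
    contribute to the first small problem, but only in the direction [i0],
    where the space G^i0 depends on its other coordinate vectors alone. *)
Variables (I I' I'' : finType).
Variables (A : I -> pred 'I_k) (A' : I' -> pred 'I_k) (A'' : I'' -> pred 'I_k).
Variables (phi' : I' -> I) (phi'' : I'' -> I) (side : pred I).
Hypothesis phi'_inj : injective phi'.
Hypothesis phi''_inj : injective phi''.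
Hypothesis A'_sub : forall l i, A' l i -> A (phi' l) i.
Hypothesis A''_sub : forall l i, A'' l i -> A (phi'' l) i.
Hypothesis A'_side : forall l i, A' l i -> i = i0 \/ side (phi' l).
Hypothesis A''_side : forall l i, A'' l i -> i = i0 \/ ~~ side (phi'' l).

Lemma extend_along (J : finType) (phi : J -> I) (m o : 'I_k -> nat)
    (v : J -> segre F m) :
  injective phi -> (forall i, o i + m i <= n i)%N ->
  exists u : I -> factors F n, forall l i, crop (m i) (o i) (u (phi l) i) = v l i.
Proof.
move=> phi_inj fit.
have /fin_all_exists[u uE] (x : I) : exists w : factors F n,
    forall l, phi l = x -> forall i, crop (m i) (o i) (w i) = v l i.
  have [/existsP[l /eqP lx]|] := boolP [exists l, phi l == x].
    exists (fun i => pad (n i) (o i) (v l i)) => l' l'x i.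
    by rewrite (padK (fit i)); congr (v _ i); apply: phi_inj; rewrite lx.
  rewrite negb_exists => /forallP no_l; exists (fun=> 0) => l /eqP lx.
  by have := no_l l; rewrite lx.
by exists u => l i; apply: uE.
Qed.

(** One family [u] serves both problems: each condition on [u] holds at all but
    finitely many points of a line. *)
Lemma joint_config (P' : (I' -> segre F n') -> Prop)
    (P'' : (I'' -> segre F n'') -> Prop) :
  generic P' -> generic P'' ->
  exists (u : I -> factors F n) v' v'', [/\ P' v', P'' v'',
    forall l i, v' l i = crop (n' i) (offset' i) (u (phi' l) i) &
    forall l i, v'' l i = crop (n'' i) (offset'' i) (u (phi'' l) i)].
Proof.
move=> /generic_witness[w' line'] /generic_witness[w'' line''].
have [u0 u0E] := extend_along w' phi'_inj fit'.
have [u1 u1E] := extend_along w'' phi''_inj fit''.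
(* [u0] projects to a good configuration of the first problem and [u1] to one
   of the second; the line is parametrised to meet them at 0 and at 1. *)
pose d x i := u1 x i - u0 x i.
have [|q' q'0 q'P] := line' (fun l i => crop (n' i) (offset' i) (u0 (phi' l) i))
  (fun l i => crop (n' i) (offset' i) (d (phi' l) i)) 0.
  by move=> l i; rewrite scale0r addr0 u0E.
have [|q'' q''1 q''P] := line'' (fun l i => crop (n'' i) (offset'' i) (u0 (phi'' l) i))
  (fun l i => crop (n'' i) (offset'' i) (d (phi'' l) i)) 1.
  by move=> l i; rewrite -crop_line scale1r addrC subrK u1E.
have [||t /q'P[v' P'v' v'E] /q''P[v'' P''v'' v''E]] :=
  exists_common_nonroot (p := q') (q := q'') charF0.
- by apply: contraNneq q'0 => ->; rewrite horner0.
- by apply: contraNneq q''1 => ->; rewrite horner0.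
exists (fun x i => u0 x i + t *: d x i), v', v''.
by split=> // l i; rewrite crop_line.
Qed.

(** At a point of the first block, the large span contains the image of what the
    first small span has there; at a point of the second block, the
    coordinates of [u] outside [i0] still agree with those of the first small
    configuration, so the direction [i0] contributes the image of a space
    G^i0 of that configuration.  The same holds with the blocks exchanged, and
    the two images are in direct sum. *)
Lemma glue_tangent_spans r' r'' :
  generic (fun v' : I' -> segre F n' => \dim (tangent_span A' v') = r') ->
  generic (fun v'' : I'' -> segre F n'' => \dim (tangent_span A'' v'') = r'') ->
  exists v : I -> segre F n, (r' + r'' <= \dim (tangent_span A v))%N.
Proof.
move=> gen' gen''.
have [u [v' [v'' [<- <- v'E v''E]]]] := joint_config gen' gen''.
pose x l i := if side l then pad (n i) (offset' i) (crop (n' i) (offset' i) (u l i))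
              else pad (n i) (offset'' i) (crop (n'' i) (offset'' i) (u l i)).
(* The vectors reached from a small configuration are nonzero; a nonzero value
   for all the others makes [v] a configuration of points. *)
pose y l i := if x l i == 0 then const_mx 1 else x l i.
have y_n0 l i : y l i != 0.
  rewrite /y; case: ifPn => // _; apply/eqP => /rowP/(_ 0).
  by rewrite !mxE; apply/eqP/oner_neq0.
pose v l := Segre (y_n0 l).
have v_pad' l i j : A' l i -> j != i ->
    v (phi' l) j = pad (n j) (offset' j) (v' l j).
  move=> Ali ji; rewrite /v /= /y.
  have -> : x (phi' l) j = pad (n j) (offset' j) (v' l j).
    rewrite /x v'E; case: ifPn => // side_l.
    case: (A'_side Ali) => [i_i0|]; last first.
      by rewrite (negPf side_l).
    have j0 : j != i0 by rewrite -i_i0.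
    by rewrite !cropK ?n'_out ?n''_out // /offset'' (negPf j0).
  by rewrite (negPf (pad_neq0 (fit' j) (coords_neq0 (v' l) j))).
have v_pad'' l i j : A'' l i -> j != i ->
    v (phi'' l) j = pad (n j) (offset'' j) (v'' l j).
  move=> Ali ji; rewrite /v /= /y.
  have -> : x (phi'' l) j = pad (n j) (offset'' j) (v'' l j).
    rewrite /x v''E; case: ifPn => // side_l.
    case: (A''_side Ali) => [i_i0|]; last first.
      by rewrite side_l.
    have j0 : j != i0 by rewrite -i_i0.
    by rewrite !cropK ?n'_out ?n''_out // /offset'' (negPf j0).
  by rewrite (negPf (pad_neq0 (fit'' j) (coords_neq0 (v'' l) j))).
exists v.
rewrite -(dim_tensor_inj fit') -(dim_tensor_inj fit'' (tangent_span A'' v'')).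
rewrite -dimv_disjoint_sum ?tensor_inj_disjoint //; apply: dimvS.
rewrite subv_add (tensor_inj_tangent_span A'_sub v_pad').
exact: tensor_inj_tangent_span A''_sub v_pad''.
Qed.

End Glue.

(** * Distributing the points between the two smaller problems *)

Section PointIndices.

Variables (k s : nat) (a : 'I_k -> nat).

(** Points are renumbered through the pair of the kind of the point
    ([None] for p_l, [Some i] for q_{i,j}) and its rank, so that the
    renumberings below act on plain natural numbers. *)
Definition code (x : point_index s a) : option 'I_k * nat :=
  match x with inl l => (None, val l) | inr q => (Some (tag q), val (tagged q)) end.

Definition valid_code (c : option 'I_k * nat) : bool :=
  (c.2 < if c.1 is Some i then a i else s)%N.

Definition directions (x : point_index s a) : pred 'I_k :=
  fun i => if (code x).1 is Some j then i == j else true.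

Lemma codeP x : valid_code (code x).
Proof. by case: x => [l|[i j]]; apply: ltn_ord. Qed.

Lemma code_inj : injective code.
Proof.
move=> [l|[i j]] [l'|[i' j']] //= [].
  by move=> /val_inj ->.
by move=> ii'; subst i' => /val_inj ->.
Qed.

Lemma code_surj c : valid_code c -> exists x, code x = c.
Proof.
case: c => [[i|] j] /= lt_j; last by exists (inl (Ordinal lt_j)).
by exists (inr (Tagged (fun i => 'I_(a i)) (Ordinal lt_j))).
Qed.

Local Open Scope ring_scope.
Variables (F : fieldType) (n : 'I_k -> nat).

Lemma span_atE (v : point_index s a -> segre F n) :
  span_at v = tangent_span directions v.
Proof.
apply/eqP; rewrite eqEsubv subv_add -andbA; apply/and3P; split.
- apply/subv_sumP => l _; apply/subv_sumP => i _.
  exact: Gspace_sub_tangent_span.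
- apply/subv_sumP => i _; apply/subv_sumP => j _.
  by apply: Gspace_sub_tangent_span; rewrite /directions /=.
apply/subv_sumP => -[[l|[i' j]] i] /= xi.
  apply: subv_trans (addvSl _ _); apply: (sumv_sup l) => //.
  exact: (sumv_sup i).
rewrite (eqP xi : i = i'); apply: subv_trans (addvSr _ _).
by apply: (sumv_sup i') => //; apply: (sumv_sup j).
Qed.

Lemma dim_span_at (v : point_index s a -> segre F n) :
  (\dim (span_at v) <= parameter_count n s a)%N.
Proof.
apply: leq_trans (dimv_add_leqif _ _) _.
apply: leq_add; apply: leq_trans (dimv_leq_sum _ _ _) _.
  rewrite -[X in (_ <= X * _)%N]card_ord -sum_nat_const.
  by apply: leq_sum => l _; apply: dim_Tspace.
apply: leq_sum => i _; apply: leq_trans (dimv_leq_sum _ _ _) _.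
rewrite -[X in (_ <= X * _)%N]card_ord -sum_nat_const.
by apply: leq_sum => j _; apply: dim_Gspace.
Qed.

End PointIndices.

Section Induction.

Variables (F : fieldType) (k : nat) (i0 : 'I_k).
Variables (n n' n'' a a' a'' : 'I_k -> nat) (s s' s'' : nat).
Hypothesis charF0 : [pchar F]%R =i pred0.
Hypothesis n_i0 : n i0 = n' i0 + n'' i0 + 1.
Hypothesis n'_out : forall i, i != i0 -> n' i = n i.
Hypothesis n''_out : forall i, i != i0 -> n'' i = n i.
Hypothesis def_s : s = s' + s''.
Hypothesis a'_i0 : a' i0 = a i0 + s''.
Hypothesis a''_i0 : a'' i0 = a i0 + s'.
Hypothesis def_a : forall i, i != i0 -> a i = a' i + a'' i.

Lemma parameter_count_split :
  parameter_count n s a = parameter_count n' s' a' + parameter_count n'' s'' a''.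
Proof.
rewrite /parameter_count !(bigD1 (P := predT) i0) //= n_i0 a'_i0 a''_i0 def_s.
rewrite (eq_bigr _ n'_out) (eq_bigr _ n''_out).
rewrite [\sum_(i < k | i != i0) a i * _](eq_bigr
  (fun i => a' i * (n' i + 1) + a'' i * (n'' i + 1))); last first.
  by move=> i i_out; rewrite def_a // n'_out // n''_out // mulnDl.
by rewrite big_split /=; ring.
Qed.

Lemma ambient_dim_split : ambient_dim n = ambient_dim n' + ambient_dim n''.
Proof.
rewrite /ambient_dim !(bigD1 (P := predT) i0) //= n_i0.
have -> : \prod_(i < k | i != i0) (n' i + 1) = \prod_(i < k | i != i0) (n i + 1).
  by apply: eq_bigr => i /n'_out ->.
have -> : \prod_(i < k | i != i0) (n'' i + 1) = \prod_(i < k | i != i0) (n i + 1).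
  by apply: eq_bigr => i /n''_out ->.
by rewrite -mulnDl; congr (_ * _); ring.
Qed.

(** The point of the large problem that a point of the first small one comes
    from.  The extra [s''] points q_{i0,j}, with [j >= a i0], come from the
    points p_l of the second block, numbered from [s']. *)
Definition route' (c : option 'I_k * nat) : option 'I_k * nat :=
  if c.1 is Some i then
    if (i == i0) && (a i0 <= c.2) then (None, s' + (c.2 - a i0)) else c
  else c.

(** As for [route'], with the roles of the blocks exchanged: the points p_l of
    the second block follow the [s'] points of the first one, its points
    q_{i,j} follow the [a' i] points of the first one, and the extra points
    q_{i0,j} come from the p_l with [l < s']. *)
Definition route'' (c : option 'I_k * nat) : option 'I_k * nat :=
  if c.1 is Some i then
    if i == i0 then if c.2 < a i0 then c else (None, c.2 - a i0)
    else (Some i, a' i + c.2)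
  else (None, s' + c.2).

(** The points q_{i0,j} occur in both small problems, always in the direction
    [i0], so that either side suits them. *)
Definition left_part (x : point_index s a) : bool :=
  let c := code x in c.2 < if c.1 is Some i then a' i else s'.

Lemma route'_exists : exists phi : point_index s' a' -> point_index s a,
  forall x, code (phi x) = route' (code x).
Proof.
apply: (fin_all_exists (P := fun x y => code y = route' (code x))) => x.
apply: code_surj; move: (codeP x).
case: (code x) => [[i|] j]; rewrite /valid_code /route' /=; last by lia.
have [-> /=|i_out /=] := eqVneq i i0; last by rewrite def_a //; lia.
by rewrite a'_i0; case: (leqP (a i0) j) => /= *; lia.
Qed.

Lemma route''_exists : exists phi : point_index s'' a'' -> point_index s a,
  forall x, code (phi x) = route'' (code x).
Proof.
apply: (fin_all_exists (P := fun x y => code y = route'' (code x))) => x.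
apply: code_surj; move: (codeP x).
case: (code x) => [[i|] j]; rewrite /valid_code /route'' /=; last by lia.
have [-> /=|i_out /=] := eqVneq i i0; last by rewrite def_a //; lia.
by rewrite a''_i0; case: (ltnP j (a i0)) => /= *; lia.
Qed.

Lemma route'_inj c d : valid_code s' a' c -> valid_code s' a' d ->
  route' c = route' d -> c = d.
Proof.
case: c d => [[i|] j] [[i'|] j']; rewrite /valid_code /route' /= => c_ok d_ok.
- case: ifP => [/andP[/eqP i_i0 le_j]|_]; case: ifP => [/andP[/eqP i'_i0 le_j']|_] //.
  by case=> ?; rewrite i_i0 i'_i0; congr (_, _); lia.
- by case: ifP => // /andP[/eqP ? ?] []; lia.
- by case: ifP => // /andP[/eqP ? ?] []; lia.
- by [].
Qed.

Lemma route''_inj c d : valid_code s'' a'' c -> valid_code s'' a'' d ->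
  route'' c = route'' d -> c = d.
Proof.
case: c d => [[i|] j] [[i'|] j']; rewrite /valid_code /route'' /= => c_ok d_ok.
- have [ii0|i_out] := eqVneq i i0; have [i'i0|i'_out] := eqVneq i' i0.
  + subst i i'; case: ltnP => lt_j; case: ltnP => lt_j' // [] // e.
    by congr (_, _); lia.
  + case: ltnP => lt_j // [] ii'.
    by case/eqP: i'_out; rewrite -ii'.
  + case: ltnP => lt_j // [] ii'.
    by case/eqP: i_out; rewrite ii'.
  + by case=> -> /addnI ->.
- have [ii0|i_out //] := eqVneq i i0; subst i.
  by case: ltnP => lt_j // []; lia.
- have [ii0|i_out //] := eqVneq i' i0; subst i'.
  by case: ltnP => lt_j // []; lia.
- by case=> /addnI ->.
Qed.

(** The open set is the set of all good configurations; [glue_tangent_spans]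
    provides an element of it, the upper bound [dim_span_at] forcing equality
    of dimensions. *)
Lemma generic_span_at_split :
  let good n s a := generic (fun v : point_index s a -> segre F n =>
    \dim (span_at v) = parameter_count n s a) in
  good n' s' a' -> good n'' s'' a'' -> good n s a.
Proof.
move=> good gen' gen''.
exists (fun v => \dim (span_at v) = parameter_count n s a); split=> //.
  have [|inv [S openS]] := @tangent_span_open F k n _ (@directions k s a)
      (parameter_count n s a).
    by move=> v; rewrite -span_atE; apply: dim_span_at.
  split=> [v w vw|]; first by rewrite !span_atE; apply: inv.
  by exists S => v; rewrite span_atE; apply: openS.
have [phi' phi'E] := route'_exists; have [phi'' phi''E] := route''_exists.
have phi'_inj : injective phi'.
  move=> x y xy; apply/code_inj/route'_inj; rewrite ?codeP //.
  by rewrite -!phi'E xy.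
have phi''_inj : injective phi''.
  move=> x y xy; apply/code_inj/route''_inj; rewrite ?codeP //.
  by rewrite -!phi''E xy.
have sub' x i : directions x i -> directions (phi' x) i.
  rewrite /directions phi'E /route'; case: (code x) => [[j|] l] //=.
  by case: ifP.
have sub'' x i : directions x i -> directions (phi'' x) i.
  rewrite /directions phi''E /route''; case: (code x) => [[j|] l] //=.
  by case: ifP => // _; case: ifP.
have side' x i : directions x i -> i = i0 \/ left_part (phi' x).
  rewrite /directions /left_part phi'E /route'; have := codeP x.
  case: (code x) => [[j|] l]; rewrite /valid_code /= => ok; last by right.
  move=> /eqP->; have [->|_] := eqVneq j i0; first by left.
  by right.
have side'' x i : directions x i -> i = i0 \/ ~~ left_part (phi'' x).
  rewrite /directions /left_part phi''E /route''.
  case: (code x) => [[j|] l]; rewrite /valid_code /=; last by right; lia.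
  move=> /eqP->; have [->|_] := eqVneq j i0; first by left.
  by right=> /=; lia.
have gen_eq n1 s1 a1 : good n1 s1 a1 ->
    generic (fun v : point_index s1 a1 -> segre F n1 =>
      \dim (tangent_span (@directions k s1 a1) v) = parameter_count n1 s1 a1).
  case=> U [openU Uv UP]; exists U; split=> // v /UP.
  by rewrite span_atE.
have [v] := glue_tangent_spans charF0 n_i0 n'_out n''_out phi'_inj phi''_inj
  sub' sub'' side' side'' (gen_eq _ _ _ gen') (gen_eq _ _ _ gen'').
rewrite -parameter_count_split -span_atE => le_dim.
by exists v; apply/eqP; rewrite eqn_leq dim_span_at.
Qed.

End Induction.

(* The tuples [n], [a], [a'], [a''] have length k and list the data of the
   factors after the first one, so there are k.+1 >= 1 factors in total. *)
Theorem theorem3p4 (F : fieldType) (charF0 : [pchar F]%R =i pred0)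
    (k : nat) (n1 n1' n1'' : nat) (n : k.-tuple nat)
    (s s' s'' a1 : nat) (a a' a'' : k.-tuple nat)
    (def_n1 : n1 = n1' + n1'' + 1)
    (def_s : s = s' + s'')
    (def_a : forall j : 'I_k, tnth a j = tnth a' j + tnth a'' j)
    (hT' : T_true F (cons_tuple n1' n) s' (cons_tuple (a1 + s'') a'))
    (hsub' : subabundant (cons_tuple n1' n) s' (cons_tuple (a1 + s'') a'))
    (hT'' : T_true F (cons_tuple n1'' n) s'' (cons_tuple (a1 + s') a''))
    (hsub'' : subabundant (cons_tuple n1'' n) s'' (cons_tuple (a1 + s') a'')) :
  T_true F (cons_tuple n1 n) s (cons_tuple a1 a) /\
  subabundant (cons_tuple n1 n) s (cons_tuple a1 a).
Proof.
have n'_out i : i != ord0 -> tnth (cons_tuple n1' n) i = tnth (cons_tuple n1 n) i.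
  by case: (unliftP ord0 i) => [j ->|->]; rewrite ?eqxx // !tnthS.
have n''_out i : i != ord0 -> tnth (cons_tuple n1'' n) i = tnth (cons_tuple n1 n) i.
  by case: (unliftP ord0 i) => [j ->|->]; rewrite ?eqxx // !tnthS.
have a_out i : i != ord0 -> tnth (cons_tuple a1 a) i =
    tnth (cons_tuple (a1 + s'') a') i + tnth (cons_tuple (a1 + s') a'') i.
  by case: (unliftP ord0 i) => [j ->|->]; rewrite ?eqxx // !tnthS.
have sub : subabundant (cons_tuple n1 n) s (cons_tuple a1 a).
  rewrite /subabundant (parameter_count_split (i0 := ord0) def_n1 n'_out n''_out
    def_s erefl erefl a_out).
  by rewrite (ambient_dim_split (i0 := ord0) def_n1 n'_out n''_out) leq_add.
split=> //; move: hT' hT''; rewrite /T_true.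
rewrite (minn_idPl hsub') (minn_idPl hsub'') (minn_idPl sub).
exact: (generic_span_at_split (i0 := ord0)).
Qed.
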